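(* There is an absolute constant $c>0$ such that every acyclic graph $G$ of order $n$ satisfies $\operatorname{bdim}(G)\ge c\sqrt{n}$, i.e. $\operatorname{bdim}(G)=\Omega(\sqrt n)$. Moreover this lower bound is asymptotically optimal: there is a family of acyclic graphs $G$ whose orders $n$ tend to infinity and which satisfy $\operatorname{bdim}(G)=O(\sqrt{n})$.
   Context: All graphs are finite, simple and undirected. For vertices $u,v$ of a graph $G$, $d(u,v)=d_G(u,v)$ is the length of a shortest $u$–$v$ path if $u,v$ lie in the same component, and $\infty$ otherwise. For a positive integer $k$, $d_k(u,v)=\min\{d(u,v),k+1\}$. A function $f:V(G)\to\mathbb{Z}_{\ge 0}$ is a resolving broadcast of $G$ if for any distinct $x,y\in V(G)$ there is a vertex $z$ with $f(z)>0$ and $d_{f(z)}(x,z)\neq d_{f(z)}(y,z)$. The broadcast dimension $\operatorname{bdim}(G)$ is the minimum of $\sum_{v\in V(G)} f(v)$ over all resolving broadcasts $f$ of $G$.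
   Formalization: The lower bound is stated for acyclic graphs of order n ≥ 2, since for the one-vertex graph the zero function is vacuously a resolving broadcast, so its broadcast dimension is 0 and the inequality fails for every c > 0. *)

(* Defs.v *)
From mathcomp Require Import all_boot.

Set Implicit Arguments.
Unset Strict Implicit.
Unset Printing Implicit Defensive.

Record sgraph := SGraph {
  vertex :> finType;
  adj : rel vertex;
  adj_sym : symmetric adj;
  adj_irr : irreflexive adj }.

Definition acyclic (G : sgraph) : Prop :=
  forall c : seq G, 2 < size c -> uniq c -> ~~ cycle (@adj G) c.

Section Broadcast.
Variable G : sgraph.
Implicit Types (u v x y z : G) (k : nat).

Definition has_path k u v : bool :=
  [exists p : k.-tuple G,
    [&& path (@adj G) u p, uniq (u :: p) & last u p == v]].

(* None stands for infinite distance. A path has at most #|G| vertices, so    *)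
(* only the lengths below #|G| need to be searched.                           *)
Definition dist u v : option nat :=
  ohead [seq k <- iota 0 #|G| | has_path k u v].

Definition tdist k u v : nat :=
  if dist u v is Some d then minn d k.+1 else k.+1.

Definition resolving_broadcast (f : G -> nat) : bool :=
  [forall x, forall y, (x != y) ==>
    [exists z, (0 < f z) && (tdist (f z) x z != tdist (f z) y z)]].

(* A broadcast of total cost k takes its values in 'I_k.+1, which makes the   *)
(* existence of one decidable; see bdimP for the unrestricted minimality.     *)
Definition has_broadcast k : bool :=
  [exists f : {ffun G -> 'I_k.+1},
    resolving_broadcast (fun v => f v : nat) && (\sum_v f v == k)].

Lemma has_broadcastP k :
  reflect (exists2 f : G -> nat, resolving_broadcast f & \sum_v f v = k)
          (has_broadcast k).
Proof.
apply: (iffP existsP) => [[f /andP[fR /eqP fk]]|[f fR fk]].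
  by exists (fun v => f v : nat).
have lef v : f v < k.+1 by rewrite ltnS -fk (bigD1 v) //= leq_addr.
exists [ffun v => Ordinal (lef v)]; apply/andP; split; last first.
  by apply/eqP; rewrite -[RHS]fk; apply: eq_bigr => v _; rewrite ffunE.
apply/forallP => x; apply/forallP => y; apply/implyP => xy.
have /existsP[z zP] := implyP (forallP (forallP fR x) y) xy.
by apply/existsP; exists z; rewrite ffunE.
Qed.

Lemma has_pathP k u v :
  reflect (exists p : seq G,
             [/\ size p = k, path (@adj G) u p, uniq (u :: p) & last u p = v])
          (has_path k u v).
Proof.
apply: (iffP existsP) => [[p /and3P[pP pU /eqP pv]]|[p [pk pP pU pv]]].
  by exists p; rewrite size_tuple.
have pk' : size p == k by apply/eqP.
by exists (Tuple pk'); rewrite /= pv eqxx andbT; apply/andP.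
Qed.

Lemma has_path_lt k u v : has_path k u v -> k < #|G|.
Proof.
by case/has_pathP => p [<- _ pU _]; rewrite -[_.+1]/(size (u :: p)) -(card_uniqP pU) max_card.
Qed.

Lemma dist_SomeP u v k :
  dist u v = Some k <-> has_path k u v /\ forall j, has_path j u v -> k <= j.
Proof.
have sP : sorted ltn [seq k <- iota 0 #|G| | has_path k u v].
  by apply: sorted_filter; [exact: ltn_trans | exact: iota_ltn_sorted].
have mP j : (j \in [seq k <- iota 0 #|G| | has_path k u v]) = has_path j u v.
  rewrite mem_filter mem_iota /= add0n andb_idr //; exact: has_path_lt.
rewrite /dist; move: sP mP.
case: [seq k <- iota 0 #|G| | has_path k u v] => [_ mP|a s /= sP mP].
  by split=> // -[]; rewrite -mP.
have aP j : has_path j u v -> a <= j.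
  rewrite -mP inE => /predU1P[-> //|js].
  by have /allP/(_ _ js)/ltnW := order_path_min ltn_trans sP.
have a_in : has_path a u v by rewrite -mP mem_head.
split=> [[<-] //|[kP kmin]]; congr Some; apply/eqP.
by rewrite eqn_leq aP // kmin.
Qed.

Lemma dist_NoneP u v : dist u v = None <-> ~~ connect (@adj G) u v.
Proof.
rewrite /dist; split=> [dN|uv].
  apply/negP => /connectP[p pP vE]; move: dN; rewrite vE {v vE}.
  case/shortenP: pP => q qP qU _ dN.
  have hq : has_path (size q) u (last u q) by apply/has_pathP; exists q.
  have : size q \in [seq k <- iota 0 #|G| | has_path k u (last u q)].
    by rewrite mem_filter hq mem_iota /= add0n; apply: has_path_lt hq.
  by case: [seq k <- iota 0 #|G| | has_path k u (last u q)] dN.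
case E: [seq k <- iota 0 #|G| | has_path k u v] => [|a s] //.
have : a \in a :: s by rewrite mem_head.
rewrite -E mem_filter => /andP[/has_pathP[p [_ pP _ pv]] _].
by case/negP: uv; apply/connectP; exists p.
Qed.

Lemma has_broadcast_ex : exists k, has_broadcast k.
Proof.
exists (\sum_(v : G) 1); apply/has_broadcastP; exists (fun=> 1) => //.
apply/forallP => x; apply/forallP => y; apply/implyP => xy.
apply/existsP; exists x; rewrite /= /tdist.
have -> : dist x x = Some 0.
  by apply/dist_SomeP; split=> //; apply/has_pathP; exists [::].
case E: (dist y x) => [[|d]|//].
  case/dist_SomeP: E => /has_pathP[p [/size0nil -> _ _ /= yx]] _.
  by rewrite yx eqxx in xy.
by rewrite min0n minnSS.
Qed.

Definition bdim : nat := ex_minn has_broadcast_ex.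

Lemma bdimP :
  (exists2 f : G -> nat, resolving_broadcast f & \sum_v f v = bdim) /\
  forall f : G -> nat, resolving_broadcast f -> bdim <= \sum_v f v.
Proof.
rewrite /bdim; case: ex_minnP => k /has_broadcastP kP kmin.
by split=> // f fR; apply: kmin; apply/has_broadcastP; exists f.
Qed.

End Broadcast.

(* Main.v *)
(** In a forest the distance satisfies the four-point condition. Given a
    resolving broadcast [f] and a vertex [x], let [Z] be the set of the [z]
    with [f z > 0] that reach [x], and let [z1], [z2] in [Z], possibly equal,
    minimize the Gromov product based at [x]. Then for every [z] in [Z],
    [d(x,z) + d(z1,z2) = max (d(x,z2) + d(z,z1)) (d(x,z1) + d(z,z2))],
    while [<=] holds for every [z] of the component. Hence the quadruple
    [(z1, d(x,z1), z2, d(x,z2))] determines [x], and a broadcast of cost [b]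
    gives at most [1 + (2b)^2] vertices.
    Conversely, in a comb with [k] teeth of [k] vertices, the distances to
    both ends of the spine determine a vertex, so two vertices broadcasting at
    strength [2(k-1)] resolve [k^2] vertices. *)
Require Import Defs.
From mathcomp Require Import all_boot all_order all_algebra reals.
From mathcomp Require Import zify.

Set Implicit Arguments.
Unset Strict Implicit.
Unset Printing Implicit Defensive.

(** * Common prefixes of sequences *)

Section CommonPrefix.
Variable T : eqType.
Implicit Types p q r : seq T.

Fixpoint lcp p q : nat :=
  match p, q with
  | a :: p', b :: q' => if a == b then (lcp p' q').+1 else 0
  | _, _ => 0
  end.

Lemma lcpC p q : lcp p q = lcp q p.
Proof. by elim: p q => [|a p IHp] [|b q] //=; rewrite eq_sym IHp. Qed.

Lemma lcp_size p q : lcp p q <= size p.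
Proof. by elim: p q => [|a p IHp] [|b q] //=; case: eqP => // _; apply: IHp. Qed.

(** Prefixes of [q] are nested, so the shorter of the two shared ones is also shared by [p] and
    [r]. *)
Lemma lcp_ultra p q r : minn (lcp p q) (lcp q r) <= lcp p r.
Proof.
elim: p q r => [|a p IHp] [|b q] [|c r] //=; rewrite ?minn0 ?min0n //.
case: (a =P b) => [->|_]; last by rewrite min0n.
by case: eqP => _; rewrite ?minn0 // minnSS ltnS IHp.
Qed.

End CommonPrefix.

(** * Distances in arbitrary graphs *)

Section Distance.
Variable G : sgraph.
Implicit Types (u v w t x y z : G) (p q : seq G).

Lemma rev_adj_path u p :
  path (@adj G) (last u p) (rev (belast u p)) = path (@adj G) u p.
Proof. by rewrite rev_path; apply: eq_path => a b; rewrite adj_sym. Qed.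

Lemma has_pathC k u v : has_path k u v = has_path k v u.
Proof.
have sub (a b : G) : has_path k a b -> has_path k b a.
  case/has_pathP => p [pk pP pU <-]; apply/has_pathP.
  exists (rev (belast a p)); split.
  - by rewrite size_rev size_belast.
  - by rewrite rev_adj_path.
  - by rewrite -rev_rcons -lastI rev_uniq.
  - by case: p {pk pP pU} => //= b' p; rewrite rev_cons last_rcons.
by apply/idP/idP; apply: sub.
Qed.

Lemma distC u v : dist u v = dist v u.
Proof. by rewrite /dist; congr ohead; apply: eq_filter => k; apply: has_pathC. Qed.

Lemma dist_connect u v k : dist u v = Some k -> connect (@adj G) u v.
Proof.
move=> uvk; apply/negPn/negP => /dist_NoneP.
by rewrite uvk.
Qed.

(** Along a walk [h] drops by at most one per step, so a walk to [z] has length at least [h u];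
    always stepping to the neighbour with smaller [h] attains this. *)
Lemma dist_potential (h : G -> nat) z :
    h z = 0 ->
    (forall u v, adj u v -> h u <= (h v).+1) ->
    (forall u, u != z -> exists2 v, adj u v & h u = (h v).+1) ->
  forall u, dist u z = Some (h u).
Proof.
move=> hz hlip hdesc u; apply/dist_SomeP.
have lower v p : path (@adj G) v p -> last v p = z -> h v <= size p.
  elim: p v => [|w p IHp] v /=; first by move=> _ ->; rewrite hz.
  by case/andP => /hlip vw wP wz; apply: leq_trans vw _; rewrite ltnS IHp.
have walk n : forall v, h v <= n ->
    exists p, [/\ size p <= n, path (@adj G) v p & last v p = z].
  elim: n => [|n IHn] v hv.
    case: (v =P z) => [->|/eqP/hdesc[w _ vw]]; first by exists [::].
    by rewrite vw in hv.
  case: (v =P z) => [->|/eqP/hdesc[w vw hvw]]; first by exists [::].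
  have [|p [pn pP pz]] := IHn w; first by rewrite -ltnS -hvw.
  by exists (w :: p); split; rewrite //= vw.
split=> [|j /has_pathP[p [<- pP _ pz]]]; last exact: lower.
have [p [pn pP pz]] := walk _ u (leqnn _).
case/shortenP: pP pz => q qP qU qp qz.
apply/has_pathP; exists q; split=> //.
by apply/eqP; rewrite eqn_leq (lower _ _ qP qz) (leq_trans _ pn) // uniq_leq_size //; case/andP: qU.
Qed.

(** Junk value: [ndist u v = 0] when [u] and [v] are not connected. *)
Definition ndist u v : nat := odflt 0 (dist u v).

Lemma ndistE u v k : dist u v = Some k -> ndist u v = k.
Proof. by rewrite /ndist => ->. Qed.

Lemma connect_ndist u v : connect (@adj G) u v -> dist u v = Some (ndist u v).
Proof.
by rewrite /ndist; case E: (dist u v) => //; move/dist_NoneP/negP: E.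
Qed.

Lemma ndistC u v : ndist u v = ndist v u.
Proof. by rewrite /ndist distC. Qed.

Lemma ndistxx u : ndist u u = 0.
Proof.
by apply: ndistE; apply/dist_SomeP; split=> //; apply/has_pathP; exists [::].
Qed.

End Distance.

(** * Unique paths and the four-point condition in forests *)

Section Forest.
Variable G : sgraph.
Hypothesis acyG : acyclic G.
Implicit Types (u v w t x y z : G) (p q : seq G).

(** Otherwise the two paths, cut at the first vertex of [p] lying on [q], would close up to a
    cycle. *)
Lemma acyclic_disjoint u p q :
    path (@adj G) u p -> path (@adj G) u q -> uniq (u :: p) -> uniq (u :: q) ->
    ohead p != ohead q ->
  ~~ has (mem q) p.
Proof.
move=> pP qP pU qU hd; apply/negP => hasP.
case/split_find: hasP pP pU hd => y p1 p2 /= yq p1q pP pU hd.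
case/path.splitP: yq qP qU p1q hd => q1 q2 qP qU p1q hd.
(* The first steps differ, so [p1] and [q1] are not both empty. *)
have sz : 2 < size (u :: p1 ++ y :: rev q1).
  move: hd; rewrite /= size_cat /= size_rev.
  by case: (p1) => [|? ?]; case: (q1) => [|? ?]; rewrite /= ?eqxx //; lia.
apply: (negP (acyG sz _)).
  move: pU qU p1q; rewrite /= !cat_uniq /= !mem_cat !mem_rcons !inE !negb_or.
  rewrite !rcons_uniq rev_uniq mem_rev !has_rev.
  case/and3P=> /andP[/andP[uy up1] _] /andP[yp1 p1U] _.
  case/and3P=> /andP[/andP[_ uq1] _] /andP[yq1 q1U] _ /hasPn p1q.
  rewrite uy up1 uq1 p1U yp1 mem_rev yq1 q1U !andbT /=.
  apply/hasPn => a /= aq; apply/negP => /p1q /=.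
  by rewrite mem_cat mem_rcons inE aq orbT.
move: pP qP; rewrite /= !cat_path => /andP[pP _] /andP[qP _].
rewrite rcons_cat rcons_cons -cat_rcons cat_path pP last_rcons /=.
by move: qP; rewrite -rev_adj_path last_rcons belast_rcons rev_cons.
Qed.

Lemma acyclic_path_inj u p q :
    path (@adj G) u p -> path (@adj G) u q -> uniq (u :: p) -> uniq (u :: q) ->
    last u p = last u q -> p = q.
Proof.
elim: p u q => [|b p IHp] u [|c q] //.
- by move=> _ _ _ /= /andP[/negP uq _] uE; case: uq; rewrite [X in X \in _]uE mem_last.
- by move=> _ _ /= /andP[/negP uq _] _ uE; case: uq; rewrite -[X in X \in _]uE mem_last.
move=> pP qP pU qU lE; case: (b =P c) => [bc|/eqP bc].
  subst c; congr cons; move: pP qP pU qU => /= /andP[_ pP] /andP[_ qP].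
  by case/andP=> _ pU /andP[_ qU]; apply: (IHp b).
have /hasPn/(_ (last b p)) := acyclic_disjoint pP qP pU qU bc.
by rewrite mem_last /= [X in X \notin _]lE /= mem_last => /(_ isT).
Qed.

Lemma acyclic_dist u p :
  path (@adj G) u p -> uniq (u :: p) -> dist u (last u p) = Some (size p).
Proof.
move=> pP pU; apply/dist_SomeP; split; first by apply/has_pathP; exists p.
by move=> j /has_pathP[q [<- qP qU /esym/(acyclic_path_inj pP qP pU qU) ->]].
Qed.

Lemma acyclic_dist_branch u p q :
    path (@adj G) u p -> path (@adj G) u q -> uniq (u :: p ++ q) ->
  dist (last u p) (last u q) = Some (size p + size q).
Proof.
move=> pP qP pqU.
have lastrev : last (last u p) (rev (belast u p)) = u.
  by case: (p) => //= b s; rewrite rev_cons last_rcons.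
have := @acyclic_dist (last u p) (rev (belast u p) ++ q).
rewrite last_cat lastrev size_cat size_rev size_belast; apply.
  by rewrite cat_path rev_adj_path pP lastrev.
rewrite -cat_cons -rev_rcons -lastI cat_uniq rev_uniq.
by move: pqU; rewrite -cat_cons cat_uniq; under [has _ q]eq_has do rewrite /= -mem_rev.
Qed.

(** The paths share their common prefix and are disjoint afterwards; the geodesic between their ends
    turns at the branching vertex. *)
Lemma acyclic_dist_lcp u p q :
    path (@adj G) u p -> path (@adj G) u q -> uniq (u :: p) -> uniq (u :: q) ->
  ndist (last u p) (last u q) = size p + size q - (lcp p q).*2.
Proof.
elim: p u q => [|b p IHp] u q.
  by move=> _ qP _ qU; rewrite subn0; apply/ndistE/acyclic_dist.
case: q => [|c q].
  by move=> pP _ pU _; rewrite addn0 subn0 ndistC; apply/ndistE/acyclic_dist.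
move=> pP qP pU qU; case: (eqVneq b c) => [bc|bc].
  subst c; move: pP qP pU qU => /= /andP[_ pP] /andP[_ qP].
  case/andP=> _ pU /andP[_ qU]; rewrite eqxx (IHp b) //; lia.
rewrite [lcp _ _]/= (negPf bc) subn0; apply/ndistE/acyclic_dist_branch => //.
rewrite -cat_cons cat_uniq pU andTb; apply/andP; split; last by case/andP: qU.
apply/negP => /hasP[a aq /=]; rewrite inE => /predU1P[aE|ap].
  by move: qU; rewrite -aE cons_uniq aq.
have /negP := acyclic_disjoint pP qP pU qU bc.
by apply; apply/hasP; exists a.
Qed.

(** With paths from [u] to the other three points, all lengths cancel and the ultrametric inequality
    [lcp_ultra] remains. *)
Lemma four_point u v w t :
    connect (@adj G) u v -> connect (@adj G) u w -> connect (@adj G) u t ->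
  ndist u v + ndist w t <= maxn (ndist u w + ndist v t) (ndist u t + ndist v w).
Proof.
move=> /connectP[_ /shortenP[p pP pU _] ->].
move=> /connectP[_ /shortenP[q qP qU _] ->] /connectP[_ /shortenP[r rP rU _] ->].
rewrite !(ndistE (acyclic_dist _ _)) // !(@acyclic_dist_lcp u) //.
have := lcp_ultra q p r; rewrite (lcpC q p).
have := lcp_size q r; have := lcp_size r q; rewrite (lcpC r q).
have := lcp_size p r; have := lcp_size r p; rewrite (lcpC r p).
have := lcp_size p q; have := lcp_size q p; rewrite (lcpC q p).
move: (lcp p q) (lcp p r) (lcp q r) (size p) (size q) (size r) => a b c i j k; lia.
Qed.

Lemma ndist_triangle u v w :
    connect (@adj G) u v -> connect (@adj G) u w ->
  ndist v w <= ndist u v + ndist u w.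
Proof.
move=> uv uw; have := four_point (connect0 _ u) uv uw.
by rewrite ndistxx add0n [ndist u w + _]addnC maxnn.
Qed.

End Forest.

(** * Truncated distances in terms of reaching vertices *)

Section Reaching.
Variables (G : sgraph) (f : G -> nat).
Implicit Types (x y z : G).

Definition reaches z x : bool :=
  (0 < f z) && (if dist x z is Some d then d <= f z else false).

Lemma reachesP z x :
  reflect [/\ 0 < f z, connect (@adj G) x z & ndist x z <= f z] (reaches z x).
Proof.
rewrite /reaches; apply: (iffP andP) => [[fz]|[fz xz le]].
  case E: (dist x z) => [d|//] dle; split=> //; first exact: dist_connect E.
  by rewrite (ndistE E).
by rewrite (connect_ndist xz).
Qed.

Lemma tdist_reaches z x : reaches z x -> tdist (f z) x z = ndist x z.
Proof. case/reachesP => _ /connect_ndist E le; rewrite /tdist E; lia. Qed.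

Lemma tdist_nreaches z x : 0 < f z -> ~~ reaches z x -> tdist (f z) x z = (f z).+1.
Proof. rewrite /reaches /tdist => ->; case: (dist x z) => [d|] //=; lia. Qed.

(** A [z] that reaches neither vertex gives both the same truncated value, so only reaching vertices
    can separate. *)
Lemma resolving_inj x y :
    resolving_broadcast f ->
    (forall z, reaches z x -> reaches z y /\ ndist y z = ndist x z) ->
    (forall z, reaches z y -> reaches z x /\ ndist x z = ndist y z) ->
  x = y.
Proof.
move=> fR xy yx; apply/eqP/negPn/negP => neq.
have /existsP[z /andP[fz /eqP[]]] := implyP (forallP (forallP fR x) y) neq.
case zx: (reaches z x).
  by have [zy yE] := xy z zx; rewrite !tdist_reaches.
case zy: (reaches z y); first by have [] := yx z zy; rewrite zx.
by rewrite !tdist_nreaches ?zx ?zy.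
Qed.

End Reaching.

(** * Encoding the vertices of a forest by extreme pairs *)

Section LowerBound.
Variables (G : sgraph) (f : G -> nat).
Hypotheses (acyG : acyclic G) (fR : resolving_broadcast f).
Implicit Types (x y z : G).

(** [z1] and [z2] minimize the Gromov product at [x] against every reaching
    vertex; the inequalities are cleared of subtractions. *)
Definition extreme_pair x z1 z2 : Prop :=
  [/\ reaches f z1 x, reaches f z2 x &
      forall z, reaches f z x ->
        ndist x z2 + ndist z z1 <= ndist x z + ndist z1 z2 /\
        ndist x z1 + ndist z z2 <= ndist x z + ndist z1 z2].

Lemma extreme_pair_ex x z : reaches f z x -> exists z1 z2, extreme_pair x z1 z2.
Proof.
move=> zx.
pose P (c : G * G) := reaches f c.1 x && reaches f c.2 x.
(* Twice the Gromov product; by the triangle inequality the subtraction never truncates on reaching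
   pairs. *)
pose h (c : G * G) := ndist x c.1 + ndist x c.2 - ndist c.1 c.2.
have P0 : P (z, z) by rewrite /P zx.
case: (arg_minnP h P0) => -[z1 z2] /andP[/= z1x z2x] hmin.
exists z1, z2; split=> // {zx P0} z zx.
have := hmin (z, z1); have := hmin (z, z2); rewrite /P /h /= zx z1x z2x.
move=> /(_ isT) le2 /(_ isT) le1.
case/reachesP: zx => _ xz _; case/reachesP: z1x => _ xz1 _.
case/reachesP: z2x => _ xz2 _.
have := ndist_triangle acyG xz1 xz2.
have := ndist_triangle acyG xz xz1; have := ndist_triangle acyG xz xz2.
lia.
Qed.

(** The four-point condition for [y, z, z1, z2] bounds [ndist y z + ndist z1 z2] by a maximum which
    extremality at [x] bounds by [ndist x z + ndist z1 z2]. *)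
Lemma extreme_pair_reaches x y z1 z2 z :
    extreme_pair x z1 z2 -> connect (@adj G) y z1 -> connect (@adj G) y z2 ->
    ndist y z1 = ndist x z1 -> ndist y z2 = ndist x z2 ->
  reaches f z x -> reaches f z y /\ ndist y z <= ndist x z.
Proof.
case=> z1x _ zmin yz1 yz2 e1 e2 zx; have [le1 le2] := zmin z zx.
case/reachesP: z1x => _ xz1 _; case/reachesP: zx => fz xz zle.
have csym : connect_sym (@adj G) by apply: sym_connect_sym; apply: adj_sym.
have yz : connect (@adj G) y z.
  by apply: connect_trans yz1 _; rewrite csym in xz1; apply: connect_trans xz1 xz.
have := four_point acyG yz yz1 yz2; rewrite e1 e2 => fp.
have yzle : ndist y z <= ndist x z by lia.
by split=> //; apply/reachesP; split=> //; apply: leq_trans zle.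
Qed.

Lemma extreme_pair_inj x y z1 z2 :
    extreme_pair x z1 z2 -> extreme_pair y z1 z2 ->
    ndist x z1 = ndist y z1 -> ndist x z2 = ndist y z2 -> x = y.
Proof.
move=> xP yP e1 e2; have [/reachesP[_ xz1 _] /reachesP[_ xz2 _] _] := xP.
have [/reachesP[_ yz1 _] /reachesP[_ yz2 _] _] := yP.
have toy := extreme_pair_reaches xP yz1 yz2 (esym e1) (esym e2).
have tox := extreme_pair_reaches yP xz1 xz2 e1 e2.
apply: (resolving_inj fR) => // z zx.
  have [zy le] := toy z zx; have [_ ge] := tox z zy.
  by split=> //; apply/eqP; rewrite eqn_leq le.
have [zy le] := tox z zx; have [_ ge] := toy z zy.
by split=> //; apply/eqP; rewrite eqn_leq le.
Qed.

(** A reaching distance is at most [f z], hence less than [2 * f z]. *)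
Let label := {z : G & 'I_(2 * f z)}.

Let label_of x (l : label) : Prop := ndist x (tag l) = tagged l :> nat.

Lemma card_forest_le : #|G| <= ((2 * \sum_v f v) ^ 2).+1.
Proof.
(* [None] encodes a vertex that nothing reaches; resolvability allows at most one, whence the extra
   1 in the count. *)
pose P x (c : option (label * label)) := if c is Some (l1, l2)
  then [/\ extreme_pair x (tag l1) (tag l2), label_of x l1 & label_of x l2]
  else forall z, ~~ reaches f z x.
have lab x z : reaches f z x -> exists2 l : label, tag l = z & label_of x l.
  case/reachesP => fz _ le; have lt : ndist x z < 2 * f z by lia.
  by exists (Tagged (fun z => 'I_(2 * f z)) (Ordinal lt)).
have codeP x : exists c, P x c.
  case: (pickP (fun z => reaches f z x)) => [z zx|none]; last first.
    by exists None => z; rewrite none.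
  have [z1 [z2 ep]] := extreme_pair_ex zx; have [z1x z2x _] := ep.
  have [l1 e1 l1P] := lab _ _ z1x; have [l2 e2 l2P] := lab _ _ z2x.
  by exists (Some (l1, l2)); split; rewrite ?e1 ?e2.
have [code codeE] := fin_all_exists codeP.
have /leq_card : injective code.
  move=> x y xy; move: (codeE x) (codeE y); rewrite xy {xy}.
  case: (code y) => [[l1 l2] /= [xP x1 x2] [yP y1 y2]|/= nx ny].
    by apply: (extreme_pair_inj xP yP); rewrite ?x1 ?x2 ?y1 ?y2.
  by apply: (resolving_inj fR) => z /idPn; rewrite ?nx ?ny.
rewrite card_option card_prod card_tagged.
by under eq_map do rewrite card_ord; rewrite sumnE big_map big_enum -big_distrr mulnn.
Qed.

(** Two vertices need a positive cost [b] to be resolved, and then [1 + 4 b^2 <= 9 b^2]. *)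
Lemma card_forest_le_sqr : 1 < #|G| -> #|G| <= (3 * \sum_v f v) ^ 2.
Proof.
move=> G2; apply: leq_trans card_forest_le _.
suff : 0 < \sum_v f v by move: (\sum_v _) => b b0; nia.
have /card_gt1P[x [y [_ _ xy]]] : 1 < #|[set: G]| by rewrite cardsT.
have /existsP[z /andP[fz _]] := implyP (forallP (forallP fR x) y) xy.
by rewrite (bigD1 z) //= ltn_addr.
Qed.

End LowerBound.

(** A vertex of maximal rank on a cycle would have two distinct neighbours of no larger rank. *)
Lemma acyclic_rank (G : sgraph) (rk : G -> nat) :
    (forall v a b, adj v a -> adj v b -> rk a <= rk v -> rk b <= rk v -> a = b) ->
  acyclic G.
Proof.
move=> rkP [|v0 c0] // sz cU; apply/negP => cP.
have v0c : v0 \in v0 :: c0 by rewrite mem_head.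
case: (@arg_maxnP _ v0 (mem (v0 :: c0)) rk v0c) => v vc vmax.
move: (v0 :: c0) vc vmax sz cU cP => c vc vmax.
have [i s cE] := rot_to vc.
rewrite -(size_rot i) -(rot_uniq i) -(rot_cycle i).
have {}vmax a : a \in rot i c -> rk a <= rk v by rewrite mem_rot; apply: vmax.
rewrite {}cE in vmax *; case: s vmax => [|a s] //.
case/lastP: s => [|s b] // vmax _ /= /and3P[_ ab _].
rewrite rcons_path last_rcons => /and3P[va _ bv].
have eab : a = b.
  by apply: (rkP v) => //; rewrite ?[adj v b]adj_sym // vmax // !inE ?mem_rcons ?mem_head ?eqxx ?orbT.
by rewrite eab mem_rcons mem_head in ab.
Qed.

(** * The comb and its broadcast from the two spine ends *)

Section Comb.
Variable m : nat.

(** The vertex [(i, j)] is at height [j] on the tooth attached to the [i]th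
    vertex [(i, 0)] of the spine. *)
Definition comb_vertex := ('I_m.+2 * 'I_m.+2)%type.

Definition comb_adj (u v : comb_vertex) : bool :=
  ((u.1 == v.1) && ((u.2.+1 == v.2 :> nat) || (v.2.+1 == u.2 :> nat))) ||
  [&& u.2 == 0 :> nat, v.2 == 0 :> nat &
      (u.1.+1 == v.1 :> nat) || (v.1.+1 == u.1 :> nat)].

Lemma comb_adj_sym : symmetric comb_adj.
Proof. by move=> [i j] [i' j']; rewrite /comb_adj /= -!val_eqE /=; lia. Qed.

Lemma comb_adj_irr : irreflexive comb_adj.
Proof. by move=> [i j]; rewrite /comb_adj /= -!val_eqE /=; lia. Qed.

Definition comb : sgraph := SGraph comb_adj_sym comb_adj_irr.

Lemma comb_acyclic : acyclic comb.
Proof.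
(* The only neighbour of no larger rank is the next one down the tooth or, on the spine, the one to
   the left. *)
apply: (@acyclic_rank comb (fun u => u.1 + u.2)) => -[i j] [i1 j1] [i2 j2].
rewrite /= /comb_adj /= -!val_eqE /= => a1 a2 le1 le2.
by congr pair; apply: val_inj => /=; lia.
Qed.

Lemma comb_card : #|comb| = m.+2 ^ 2.
Proof. by rewrite card_prod card_ord mulnn. Qed.

Lemma comb_dist_left (u : comb) : dist u (ord0, ord0) = Some (u.1 + u.2).
Proof.
apply: (dist_potential (h := fun u : comb => u.1 + u.2)) => //=.
  by move=> [i j] [i' j']; rewrite /comb_adj /= -!val_eqE /=; lia.
move=> [[i ilt] [j jlt]]; case: j jlt => [|j] jlt; last first.
  move=> _; exists (Ordinal ilt, Ordinal (ltnW jlt)) => /=; last by lia.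
  by rewrite /comb_adj /= -!val_eqE /=; lia.
case: i ilt => [|i] ilt; first by case/eqP; congr pair; apply: val_inj.
move=> _; exists (Ordinal (ltnW ilt), Ordinal jlt) => /=; last by lia.
by rewrite /comb_adj /= -!val_eqE /=; lia.
Qed.

Lemma comb_dist_right (u : comb) : dist u (ord_max, ord0) = Some (m.+1 - u.1 + u.2).
Proof.
apply: (dist_potential (h := fun u : comb => m.+1 - u.1 + u.2)) => /=.
- by rewrite subnn.
- by move=> [[i ilt] j] [[i' ilt'] j']; rewrite /comb_adj /= -!val_eqE /=; lia.
move=> [[i ilt] [j jlt]]; case: j jlt => [|j] jlt; last first.
  move=> _; exists (Ordinal ilt, Ordinal (ltnW jlt)) => /=; last by lia.
  by rewrite /comb_adj /= -!val_eqE /=; lia.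
case: (ltnP i m.+1) => [im|mi]; last first.
  by rewrite -pair_eqE /pair_eq /= -!val_eqE /=; lia.
move=> _; exists (Ordinal (im : i.+1 < m.+2), Ordinal jlt) => /=; last by lia.
by rewrite /comb_adj /= -!val_eqE /=; lia.
Qed.

Lemma comb_bdim : bdim comb <= 4 * m.+1.
Proof.
pose l : comb := (ord0, ord0); pose r : comb := (ord_max, ord0).
(* [2 * m.+1] is the largest distance from a spine end, so nothing is truncated. *)
pose f (u : comb) := if (u == l) || (u == r) then 2 * m.+1 else 0.
have -> : 4 * m.+1 = \sum_u f u.
  (* The spine has [m.+2 >= 2] vertices, so its ends differ. *)
  have lr : r != l by [].
  rewrite (bigD1 l) //= (bigD1 r) //= big1 => [|u /andP[/negPf ul /negPf ur]].
    by rewrite /f !eqxx orbT /=; lia.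
  by rewrite /f ul ur.
apply: (bdimP comb).2; apply/forallP => x; apply/forallP => y; apply/implyP => xy.
have fl : f l = 2 * m.+1 by rewrite /f eqxx.
have fr : f r = 2 * m.+1 by rewrite /f eqxx orbT.
apply: contraT => /existsPn nz.
(* The sum of the distances [i + j] and [m.+1 - i + j] determines [j], and then [i] follows. *)
move: (nz l) (nz r); rewrite fl fr /tdist !comb_dist_left !comb_dist_right.
case: x y xy {nz} => [[i ilt] [j jlt]] [[i' ilt'] [j' jlt']].
rewrite -pair_eqE /pair_eq /= -!val_eqE /=; lia.
Qed.

End Comb.

(** * Both bounds over the reals *)

Import Order.TTheory GRing.Theory Num.Theory.
Local Open Scope ring_scope.

(** The one-vertex graph has [bdim] 0, so the lower bound starts at order 2. *)
Theorem theorem1p3 (R : realType) :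
  (exists2 c : R, 0 < c &
     forall G : sgraph, acyclic G -> (2 <= #|G|)%N ->
       c * Num.sqrt #|G|%:R <= (bdim G)%:R) /\
  (exists F : nat -> sgraph,
     [/\ forall m, acyclic (F m),
         forall N : nat, exists m0 : nat, forall m, (m0 <= m)%N -> (N <= #|F m|)%N
       & exists2 C : R, 0 < C &
           forall m, (bdim (F m))%:R <= C * Num.sqrt #|F m|%:R]).
Proof.
split.
  (* The constant is the square-root form of [n <= (3 b)^2]. *)
  exists 3^-1 => [|G acyG G2]; first by rewrite invr_gt0.
  have [[f fR <-] _] := bdimP G; rewrite mulrC ler_pdivrMr // mulrC -natrM.
  rewrite -[leRHS]ger0_norm // -sqrtr_sqr ler_wsqrtr // -natrX ler_nat.
  exact: card_forest_le_sqr.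
exists comb; split; first exact: comb_acyclic.
  by move=> N; exists N => m Nm; rewrite comb_card; nia.
(* Here the square root of the order is [m.+2], and the cost is at most [4 * m.+1]. *)
exists 4 => // m; rewrite comb_card natrX sqrtr_sqr ger0_norm // -natrM ler_nat.
by apply: leq_trans (comb_bdim m) _; rewrite leq_pmul2l.
Qed.
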